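(* For each integer $N\ge 7$ there is, up to isomorphism, exactly one $K_5$ descendant of level $0$ with $N$ vertices. These graphs are precisely the $1$-zigzag graphs of order $\ge 7$.
   Context: Graphs are finite, simple and undirected, considered up to isomorphism (unlabelled). Double triangle expansion (DTE): let $G$ be a $4$-regular graph containing four distinct vertices $v_1,v_2,v_3,v_4$ such that $\{v_1,v_2,v_3\}$ is a triangle and $\{v_2,v_4\}$ is an edge. The DTE of $G$ at this subgraph is obtained by deleting the edges $\{v_1,v_3\}$ and $\{v_2,v_4\}$ and adding one new vertex adjacent to exactly $v_1,v_2,v_3,v_4$. A $K_5$ descendant is a graph obtained from $K_5$ by a finite (possibly empty) sequence of DTEs. The order of a graph is its number of vertices. The level of a graph $G$ is $L(G)=$ (number of vertices of $G$) $-$ (number of triangles of $G$). The $1$-zigzag graph $\hat Z_n$ is the circulant graph $C_{n+2}(1,2)$, i.e. the graph on $\mathbb{Z}/(n+2)$ in which $i$ and $j$ are adjacent iff $i-j\equiv\pm1$ or $\pm2 \pmod{n+2}$; it has order $n+2$. *)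

(* Defs.v *)
From mathcomp Require Import all_boot all_algebra.
Set Implicit Arguments.
Unset Strict Implicit.
Unset Printing Implicit Defensive.
Import GRing.Theory.

Record sgraph := SGraph {
  vertex :> finType;
  adj : rel vertex;
  adj_sym : symmetric adj;
  adj_irrefl : irreflexive adj
}.

Definition graph_iso (G H : sgraph) : Prop :=
  exists2 f : G -> H, bijective f & forall x y, adj (f x) (f y) = adj x y.

Definition regular (k : nat) (G : sgraph) : Prop :=
  forall x : G, #|[set y | adj x y]| = k.

Definition triangles (G : sgraph) : {set {set G}} :=
  [set T : {set G} | (#|T| == 3)
     && [forall x in T, forall y in T, (x != y) ==> adj x y]].

Definition graph_order (G : sgraph) : nat := #|G|.

Definition level (G : sgraph) : int :=
  ((graph_order G)%:Z - (#|triangles G|)%:Z)%R.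

Section Complete.
Variable n : nat.

Definition complete_adj : rel 'I_n := fun x y => x != y.

Lemma complete_sym : symmetric complete_adj.
Proof. by move=> x y; rewrite /complete_adj eq_sym. Qed.

Lemma complete_irrefl : irreflexive complete_adj.
Proof. by move=> x; rewrite /complete_adj eqxx. Qed.

Definition complete_graph : sgraph := SGraph complete_sym complete_irrefl.
End Complete.

Section DoubleTriangleExpansion.
Variables (G : sgraph) (v1 v2 v3 v4 : G).

(* The new vertex is [None]. *)
Definition dte_adj : rel (option G) := fun x y =>
  match x, y with
  | Some a, Some b =>
      [&& adj a b, [set a; b] != [set v1; v3] & [set a; b] != [set v2; v4]]
  | Some a, None | None, Some a => a \in [:: v1; v2; v3; v4]
  | None, None => false
  end.

Lemma dte_sym : symmetric dte_adj.
Proof. by move=> [a|] [b|] //=; rewrite adj_sym setUC. Qed.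

Lemma dte_irrefl : irreflexive dte_adj.
Proof. by move=> [a|] //=; rewrite adj_irrefl. Qed.

Definition dte : sgraph := SGraph dte_sym dte_irrefl.

Definition dte_site : bool :=
  [&& uniq [:: v1; v2; v3; v4],
      adj v1 v2, adj v2 v3, adj v1 v3 & adj v2 v4].
End DoubleTriangleExpansion.

Definition is_dte (G H : sgraph) : Prop :=
  regular 4 G /\
  exists v1 v2 v3 v4 : G, dte_site v1 v2 v3 v4 /\ graph_iso (dte v1 v2 v3 v4) H.

Inductive K5_descendant : sgraph -> Prop :=
| K5_descendant_base G : graph_iso (complete_graph 5) G -> K5_descendant G
| K5_descendant_step G H : K5_descendant G -> is_dte G H -> K5_descendant H.

Section Zigzag.
Variable n : nat.

(* The conjunct [i != j] only matters for n = 0, where 2 = 0 in Z/(n+2). *)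
Definition zigzag_adj : rel 'Z_n.+2 := fun i j =>
  (i != j) && (i - j \in [:: 1; - 1; 2%:R; - 2%:R])%R.

Lemma zigzag_sym : symmetric zigzag_adj.
Proof.
move=> i j; rewrite /zigzag_adj eq_sym -(opprB i j) !inE !eqr_oppLR !opprK.
by rewrite orbCA; congr (_ && [|| _, _ | _]); rewrite orbC.
Qed.

Lemma zigzag_irrefl : irreflexive zigzag_adj.
Proof. by move=> i; rewrite /zigzag_adj eqxx. Qed.

Definition zigzag1 : sgraph := SGraph zigzag_sym zigzag_irrefl.
End Zigzag.

(* Main.v *)
Require Import Defs.
From mathcomp Require Import all_boot all_algebra zify.
Set Implicit Arguments.
Unset Strict Implicit.
Unset Printing Implicit Defensive.

(** Why the theorem holds.

    Write C_N for the square of the N-cycle, that is, the 1-zigzag graph of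
    order N.  For N >= 5, expanding C_N at four consecutive vertices 0, 1, 2, 3
    deletes the edges 02 and 13 and joins a new vertex w to 0, 1, 2, 3; reading
    the vertices as 0, 1, w, 2, 3, ... shows that the result is C_(N+1)
    ([dte_cyclic_square]).  As K5 = C_5, every C_N with N >= 5 is a descendant
    ([cyclic_square_descendant]), and for N >= 7 the triangles of C_N are the N
    triples of consecutive vertices, so that its level is 0
    ([cyclic_square_triangles]).

    For the converse, follow the number of triangles through an expansion.
    Besides w v2 v3, each triangle of the expanded graph can be charged to a
    triangle of the original one: w v1 v2 to v1 v2 v3, w u v4 to v2 u v4, and a
    triangle avoiding w to itself.  Triangles v1 v3 c with c <> v2 are never
    charged.  Hence at most one triangle is gained ([dte_triangles]), so the
    level never decreases, and it stays the same only if v2 is the sole common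
    neighbour of v1 and v3 ([dte_triangles_tight]).

    In C_5 and C_6 every expansion site consists, up to exchanging v1 and v3 and
    relabelling, of four consecutive vertices, so C_6 and C_7 are the only
    descendants of order 6 and 7; the latter has level 0, and therefore all
    levels from order 7 on are nonnegative.  A descendant of level 0 and order
    greater than 7 is then an expansion of one of level 0, a C_N by induction,
    at a site where v2 is the sole common neighbour of v1 and v3.  In C_N with
    N >= 7 consecutive vertices have two common neighbours, so v1 and v3 are at
    distance two along the cycle, v2 is between them and v4 is next to one of
    them: the site is again made of four consecutive vertices
    ([dte_cyclic_square_large]). *)

(** * Isomorphisms and triangle counts *)

Lemma graph_iso_sym (G H : sgraph) : graph_iso G H -> graph_iso H G.
Proof.
case=> f [h fK hK] fadj; exists h; first by exists f.
by move=> x y; rewrite -fadj !hK.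
Qed.

Lemma graph_iso_order (G H : sgraph) : graph_iso G H -> #|G| = #|H|.
Proof. by case=> f fbij _; apply: bij_eq_card fbij. Qed.

Lemma set2_eq (T : finType) (a b c d : T) :
  ([set a; b] == [set c; d]) = ((a == c) && (b == d)) || ((a == d) && (b == c)).
Proof.
apply/eqP/idP => [E|]; last first.
  by case/orP=> /andP[/eqP-> /eqP->] //; rewrite setUC.
have := set21 a b; have := set22 a b; have := set21 c d; have := set22 c d.
rewrite {1 2}E -{1 2}E !inE.
rewrite ![c == _]eq_sym ![d == _]eq_sym.
by case: (a == c); case: (a == d); case: (b == c); case: (b == d).
Qed.

Lemma triangleP (G : sgraph) (T : {set G}) :
  reflect (exists a b c, [/\ adj a b, adj b c, adj a c & T = [set a; b; c]])
          (T \in triangles G).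
Proof.
rewrite inE; apply: (iffP andP) => [[T3 Tadj]|[a [b [c [ab bc ac ->]]]]].
  have : 2 < #|T| by rewrite (eqP T3).
  case/card_gt2P=> a [b [c [[aT bT cT] [ab bc ca]]]].
  have adjT (x y : G) : x \in T -> y \in T -> x != y -> adj x y.
    move=> xT yT; apply: implyP.
    by move/forall_inP: Tadj => /(_ x xT) /forall_inP /(_ y yT).
  exists a, b, c; split; try by [apply: adjT | rewrite adj_sym adjT].
  apply/esym/eqP; rewrite eqEcard (eqP T3).
  rewrite -setUA !subUset !sub1set aT bT cT /=.
  by rewrite cardsU1 cards2 !inE negb_or ab [a == c]eq_sym ca bc.
have ne (x y : G) : adj x y -> x != y.
  by move=> xy; apply: contraTneq xy => ->; rewrite adj_irrefl.
split.
  rewrite -setUA cardsU1 cards2 !inE negb_or (ne _ _ ab) (ne _ _ ac).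
  by rewrite (ne _ _ bc).
apply/forall_inP=> x; rewrite !inE => xT; apply/forall_inP=> y; rewrite !inE => yT.
apply/implyP; case/orP: xT => [/orP[]|] /eqP->; case/orP: yT => [/orP[]|] /eqP->;
  by rewrite ?eqxx // adj_sym.
Qed.

Lemma card_triangles_iso (G H : sgraph) :
  graph_iso G H -> #|triangles G| = #|triangles H|.
Proof.
have half (A B : sgraph) : graph_iso A B -> #|triangles B| <= #|triangles A|.
  case=> f [h fK hK] fadj.
  apply: leq_trans (leq_imset_card (fun T : {set A} => f @: T) _).
  apply/subset_leq_card/subsetP=> T /triangleP[a [b [c [ab bc ac ->]]]].
  apply/imsetP; exists [set h a; h b; h c].
    by apply/triangleP; exists (h a), (h b), (h c); rewrite -!fadj !hK.
  by rewrite !imsetU !imset_set1 !hK.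
by move=> GH; apply/eqP; rewrite eqn_leq !half //; exact: graph_iso_sym.
Qed.

Lemma level0P (G : sgraph) : level G = 0%R <-> #|triangles G| = #|G|.
Proof. by rewrite /level /graph_order; move: #|G| #|triangles G| => n t; lia. Qed.

(** * Squares of cycles as labelled graphs *)

(** Cyclic distance 1 or 2 among the residues below [N], written with additions
    of naturals only, so that facts about it are facts of linear arithmetic. *)
Definition cyc_adj (N i j : nat) : bool :=
  [|| i + 1 == j, i + 2 == j, j + 1 == i, j + 2 == i,
      i + N == j + 1, i + N == j + 2, j + N == i + 1 | j + N == i + 2].

(** An isomorphism onto the square of the [N]-cycle, encoded as a map to [nat]
    so that relabellings are plain arithmetic functions; its surjectivity onto
    the numbers below [N] follows from the cardinality condition. *)
Definition cyc_labelling (N : nat) (G : sgraph) (g : G -> nat) : Prop :=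
  [/\ #|G| = N, injective g, forall x, g x < N
    & forall x y, adj x y = cyc_adj N (g x) (g y)].

Definition cyclic_square (N : nat) (G : sgraph) : Prop :=
  exists g : G -> nat, cyc_labelling N g.

Lemma labelling_onto N (G : sgraph) (g : G -> nat) k :
  cyc_labelling N g -> k < N -> exists x, g x = k.
Proof.
case=> EN ginj gN _ kN.
have oinj : injective (fun x => Ordinal (gN x)).
  by move=> x y /(congr1 val) /= /ginj.
have [|h _ hK] := inj_card_bij oinj; first by rewrite card_ord EN.
by exists (h (Ordinal kN)); have /(congr1 val) := hK (Ordinal kN).
Qed.

Lemma cyclic_square_iso N (G H : sgraph) :
  graph_iso G H -> cyclic_square N G -> cyclic_square N H.
Proof.
move=> /graph_iso_sym GH [g [<- ginj gN gadj]].
have EN := graph_iso_order GH; case: GH => f fbij fadj.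
exists (g \o f); split=> [||x|x y] //=.
- exact: inj_comp ginj (bij_inj fbij).
- by rewrite -gadj fadj.
Qed.

Lemma cyclic_square_unique N (G H : sgraph) :
  cyclic_square N G -> cyclic_square N H -> graph_iso G H.
Proof.
move=> [g [EG ginj gN gadj]] [h hL]; case: (hL) => EH hinj hN hadj.
have ex x : exists y, h y == g x.
  by have [y <-] := labelling_onto hL (gN x); exists y.
pose f x := xchoose (ex x); have fE x : h (f x) = g x by apply/eqP/(xchooseP (ex x)).
exists f; last by move=> x y; rewrite hadj !fE gadj.
apply: inj_card_bij; last by rewrite EG EH.
by move=> x y fxy; apply: ginj; rewrite -!fE fxy.
Qed.

Lemma complete5_cyclic_square : cyclic_square 5 (complete_graph 5).
Proof.
exists val; have E5 : #|complete_graph 5| = 5 by exact: card_ord.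
split=> //; first exact: val_inj.
  by move=> x; exact: ltn_ord.
move=> x y; have := ltn_ord x; have := ltn_ord y.
by rewrite /= /complete_adj /cyc_adj -val_eqE /=; lia.
Qed.

Lemma zigzag_order n : #|zigzag1 n| = n.+2.
Proof. exact: card_ord. Qed.

Lemma zigzag_cyclic_square n : 3 <= n -> cyclic_square n.+2 (zigzag1 n).
Proof.
move=> n3; exists val; split; first exact: zigzag_order; first exact: val_inj.
  by move=> x; exact: ltn_ord.
move=> i j; rewrite /= /zigzag_adj.
have wrap k : k < n.+2 + n.+2 -> k %% n.+2 = if k < n.+2 then k else k - n.+2.
  have [/modn_small-> //|h kN] := ltnP k n.+2.
  by rewrite -{1}(subnK h) modnDr modn_small // ltn_subLR.
have E1 (a b : 'Z_n.+2) :
    (a - b == 1)%R = ((a == b + 1 :> nat) || (a + n.+2 == b + 1 :> nat)).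
  rewrite GRing.subr_eq -val_eqE /=; have := ltn_ord a; have := ltn_ord b.
  rewrite /= /Zp_trunc /= => bN aN; rewrite (@modn_small 1) // addnC.
  by rewrite wrap; [case: ifP|]; lia.
have E2 (a b : 'Z_n.+2) :
    (a - b == 2%:R)%R = ((a == b + 2 :> nat) || (a + n.+2 == b + 2 :> nat)).
  rewrite GRing.subr_eq -val_eqE /=; have := ltn_ord a; have := ltn_ord b.
  rewrite /= /Zp_trunc /= => bN aN.
  have -> : (1 + 1 %% n.+2) %% n.+2 = 2 by rewrite !modn_small //; lia.
  by rewrite addnC wrap; [case: ifP|]; lia.
rewrite !inE -!GRing.eqr_oppLR GRing.opprB !E1 !E2 -val_eqE /= /cyc_adj.
have := ltn_ord i; have := ltn_ord j; rewrite /= /Zp_trunc /=; lia.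
Qed.

(** Rotations and reflections of the cycle: they bring a site to a standard
    position, so that only finitely many relative positions have to be examined. *)
Lemma labelling_rotate N (G : sgraph) (g : G -> nat) c :
  5 <= N -> c < N -> cyc_labelling N g ->
  cyc_labelling N (fun x => if c <= g x then g x - c else g x + N - c).
Proof.
move=> N5 cN [EG ginj gN gadj]; split=> // [x y|x|x y].
- move=> h; apply: ginj; move: h; have := gN x; have := gN y; do 2!case: ifP; lia.
- have := gN x; case: ifP; lia.
rewrite gadj /cyc_adj; have := gN x; have := gN y; do 2!case: ifP; lia.
Qed.

Lemma labelling_reflect N (G : sgraph) (g : G -> nat) c :
  5 <= N -> c < N -> cyc_labelling N g ->
  cyc_labelling N (fun x => if g x <= c then c - g x else c + N - g x).
Proof.
move=> N5 cN [EG ginj gN gadj]; split=> // [x y|x|x y].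
- move=> h; apply: ginj; move: h; have := gN x; have := gN y; do 2!case: ifP; lia.
- have := gN x; case: ifP; lia.
rewrite gadj /cyc_adj; have := gN x; have := gN y; do 2!case: ifP; lia.
Qed.

(** The four neighbours carry the residues of [g x + d] for [d] equal to 1, 2,
    [N - 1] and [N - 2], which are distinct because [N] is at least 5. *)
Lemma cyclic_square_regular N (G : sgraph) :
  5 <= N -> cyclic_square N G -> regular 4 G.
Proof.
move=> N5 [g gL] x; have [EG ginj gN gadj] := gL; have xN := gN x.
have nb d : d < N -> exists y, g y = g x + d \/ g y + N = g x + d.
  move=> dN; have [h|h] := ltnP (g x + d) N.
    by have [y e] := labelling_onto gL h; exists y; left.
  have [|y e] := @labelling_onto N G g (g x + d - N) gL; first by lia.
  by exists y; right; lia.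
have [|y1 h1] := nb 1; first by lia.
have [|y2 h2] := nb 2; first by lia.
have [|y3 h3] := nb (N - 1); first by lia.
have [|y4 h4] := nb (N - 2); first by lia.
have geq y z : (y == z) = (g y == g z) by rewrite (inj_eq ginj).
have l1 := gN y1; have l2 := gN y2; have l3 := gN y3; have l4 := gN y4.
have /card_uniqP /= <- : uniq [:: y1; y2; y3; y4].
  by rewrite /= !inE !geq; lia.
by apply: eq_card => y; rewrite !inE gadj !geq /cyc_adj; have := gN y; lia.
Qed.

(** * Triangles of the square of a cycle *)

Definition cyc_next (N i j : nat) : bool := (j == i + 1) || (j + N == i + 1).

(** Going around the cycle through three pairwise close vertices would take
    steps of size at most 2, hence [N <= 6]; so for larger [N] they are
    consecutive, and the six disjuncts are their possible orders. *)
Lemma cyc_adj_triangle N i j k :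
  7 <= N -> i < N -> j < N -> k < N ->
  cyc_adj N i j -> cyc_adj N j k -> cyc_adj N i k ->
  [|| cyc_next N i j && cyc_next N j k, cyc_next N i k && cyc_next N k j,
      cyc_next N j i && cyc_next N i k, cyc_next N j k && cyc_next N k i,
      cyc_next N k i && cyc_next N i j | cyc_next N k j && cyc_next N j i].
Proof.
move=> N7 iN jN kN ij jk; rewrite /cyc_adj => ik.
repeat case/orP: ij => ij; repeat case/orP: jk => jk;
  move: ij jk => /eqP ij /eqP jk; try (exfalso; lia);
  repeat case/orP: ik => ik; move: ik => /eqP ik; try (exfalso; lia).
all: rewrite /cyc_next.
all: by do ! (apply/andP; split; apply/orP; first [left; lia | right; lia])
  || (apply/orP; first [ left; apply/andP; split; apply/orP;
                         first [left; lia | right; lia] | right ]).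
Qed.

Lemma cyclic_square_triangles N (G : sgraph) :
  7 <= N -> cyclic_square N G -> #|triangles G| = N.
Proof.
move=> N7 [g gL]; case: (gL) => EG ginj gN gadj.
have ex x : exists y, g y == if (g x).+1 < N then (g x).+1 else 0.
  have [|y <-] := @labelling_onto N G g (if (g x).+1 < N then (g x).+1 else 0) gL.
    by case: ifP; lia.
  by exists y.
pose s x := xchoose (ex x).
have sE x : g (s x) = if (g x).+1 < N then (g x).+1 else 0.
  by apply/eqP/(xchooseP (ex x)).
have geq x y : (x == y) = (g x == g y) by rewrite (inj_eq ginj).
have sadj x y : (y == s x) = cyc_next N (g x) (g y).
  by rewrite geq sE /cyc_next; have := gN x; have := gN y; case: ifP; lia.
pose tr x := [set x; s x; s (s x)].
have trinj : injective tr.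
  move=> x y E; apply: ginj.
  have : x \in tr y by rewrite -E !inE eqxx.
  have : s (s x) \in tr y by rewrite -E !inE eqxx !orbT.
  have : s x \in tr y by rewrite -E !inE eqxx !orbT.
  rewrite !inE !geq !sE; have := gN x; have := gN y.
  repeat case: ifP; lia.
rewrite -EG -cardsT -(card_imset _ trinj); apply: eq_card => T.
apply/triangleP/imsetP=> [[a [b [c [ab bc ac ->]]]]|[x _ ->]].
  have : [|| (b == s a) && (c == s b), (c == s a) && (b == s c),
             (a == s b) && (c == s a), (c == s b) && (a == s c),
             (a == s c) && (b == s a) | (b == s c) && (a == s b)].
    by rewrite !sadj; apply: cyc_adj_triangle; rewrite -?gadj.
  have trP x y z : [set a; b; c] = [set x; y; z] -> (y == s x) && (z == s y) ->
                   exists2 x0, x0 \in [set: G] & [set a; b; c] = tr x0.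
    by move=> -> /andP[/eqP-> /eqP->]; exists x.
  case/or3P=> [||/or4P[]]; apply: trP; apply/setP=> t; rewrite !inE;
    by case: (t == a); case: (t == b); case: (t == c).
exists x, (s x), (s (s x)); split=> //; rewrite gadj /cyc_adj !sE; have := gN x;
  repeat case: ifP; lia.
Qed.

(** * Triangles under double triangle expansion *)

(** The map [psi] sends a triangle of [G] to the triangle charged to it. It
    suffices that its values, together with the triangle of the new vertex with
    [v2] and [v3], cover all the triangles of the expansion, even after the
    triangles on the edge [v1 v3] that avoid [v2] are left out. *)
Lemma dte_triangles (G : sgraph) (v1 v2 v3 v4 : G) :
  dte_site v1 v2 v3 v4 ->
  #|triangles (dte v1 v2 v3 v4)| +
    #|[set T in triangles G | [&& v1 \in T, v3 \in T & v2 \notin T]]|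
  <= #|triangles G|.+1.
Proof.
case/and5P; rewrite /= !inE !negb_or.
case/and4P=> /and3P[n12 n13 n14] /andP[n23 n24] n34 _.
move=> a12 a23 a13 a24.
set H := dte v1 v2 v3 v4; set X := [set T in _ | _].
pose psi (S : {set G}) : {set H} :=
  if (v2 \in S) && (v4 \in S) then None |: Some @: (S :\ v2)
  else if [&& v1 \in S, v2 \in S & v3 \in S] then None |: Some @: (S :\ v3)
  else Some @: S.
suff cover : triangles H \subset
    (None |: Some @: [set v2; v3]) |: psi @: (triangles G :\: X).
  have Xsub : X \subset triangles G by apply/subsetP => T; rewrite inE => /andP[].
  rewrite -(cardsID X (triangles G)) (setIidPr Xsub) addnC -addnS leq_add2l.
  apply: leq_trans (subset_leq_card cover) _; rewrite cardsU1 -add1n.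
  by rewrite leq_add ?leq_b1 ?leq_imset_card.
have avoid (u w a b c : G) : u != w -> [set a; b] != [set u; w] ->
    [set b; c] != [set u; w] -> [set a; c] != [set u; w] ->
    ~~ ((u \in [set a; b; c]) && (w \in [set a; b; c])).
  move=> uw h1 h2 h3; apply/negP; rewrite !inE -!orbA.
  case/andP=> /or3P[]/eqP eu /or3P[]/eqP ew; move: uw h1 h2 h3;
    by rewrite eu ew !set2_eq ?eqxx ?orbT.
have old (S : {set G}) : S \in triangles G ->
    ~~ [&& v1 \in S, v3 \in S & v2 \notin S] ->
    psi S \in psi @: (triangles G :\: X).
  by move=> ST SX; apply: imset_f; rewrite in_setD ST andbT inE ST.
(* The triangle [v1 v2 v3] disappears and is charged with that of the new vertex,
   [v1] and [v2]. *)
have w12 : (None |: Some @: [set v1; v2] : {set H}) \in psi @: (triangles G :\: X).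
  have <- : psi [set v1; v2; v3] = None |: Some @: [set v1; v2].
    rewrite /psi !inE !eqxx !orbT /= ![v4 == _]eq_sym.
    rewrite (negPf n14) (negPf n24) (negPf n34) /=.
    suff -> : [set v1; v2; v3] :\ v3 = [set v1; v2] by [].
    apply/setP=> x; rewrite !inE; have [->|] := eqVneq x v3; rewrite ?orbF //=.
    by rewrite ![v3 == _]eq_sym (negPf n13) (negPf n23).
  apply: old; last by rewrite !inE !eqxx !orbT.
  by apply/triangleP; exists v1, v2, v3.
(* If [v4] is adjacent to [v1] or [v3], deleting [v2 v4] destroys one triangle,
   and the new vertex creates another one in its place. *)
have w4 u : u = v1 \/ u = v3 -> adj u v4 ->
    (None |: Some @: [set u; v4] : {set H}) \in psi @: (triangles G :\: X).
  move=> u13 au4.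
  have a2u : adj v2 u by case: u13 => ->; rewrite // adj_sym.
  have n2u : v2 != u by apply: contraTneq a2u => ->; rewrite adj_irrefl.
  have <- : psi [set v2; u; v4] = None |: Some @: [set u; v4].
    rewrite /psi !inE !eqxx !orbT /=.
    suff -> : [set v2; u; v4] :\ v2 = [set u; v4] by [].
    apply/setP=> x; rewrite !inE; have [->|] := eqVneq x v2; rewrite //=.
    by rewrite (negPf n2u) (negPf n24).
  apply: old; last by rewrite !inE eqxx !andbF.
  by apply/triangleP; exists v2, u, v4.
have new (a b : H) : adj (None : H) a -> adj (None : H) b -> adj a b ->
    [set (None : H); a; b] \in
      (None |: Some @: [set v2; v3]) |: psi @: (triangles G :\: X).
  case: a b => [a|] [b|] //= al bl /and3P[ab n13' n24'].
  have -> : [set None; Some a; Some b] = None |: Some @: [set a; b].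
    by rewrite imsetU !imset_set1 setUA.
  move: al bl ab n13' n24'; rewrite in_setU1 !inE.
  case/or4P=> /eqP->; case/or4P=> /eqP->; rewrite ?adj_irrefl ?eqxx // => ab;
    rewrite ?[[set v3; v1]]setUC ?[[set v4; v2]]setUC ?eqxx // => _ _;
    rewrite ?w12 ?orbT //.
  - by rewrite w4 ?orbT //; left.
  - by rewrite [[set v2; v1]]setUC w12 orbT.
  - by rewrite [[set v3; v2]]setUC eqxx.
  - by rewrite w4 ?orbT //; right.
  - by rewrite [[set v4; v1]]setUC w4 ?orbT 1?adj_sym //; left.
  - by rewrite [[set v4; v3]]setUC w4 ?orbT 1?adj_sym //; right.
apply/subsetP=> T /triangleP[x [y [z [xy yz xz ->]]]].
case: x y z xy yz xz => [a|] [b|] [c|] ab bc ac.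
- rewrite in_setU; apply/orP; right.
  case/and3P: ab => ab ab1 ab2; case/and3P: bc => bc bc1 bc2.
  case/and3P: ac => ac ac1 ac2.
  (* A triangle of old vertices has no deleted edge, so [psi] fixes it. *)
  have no13 := avoid _ _ _ _ _ n13 ab1 bc1 ac1.
  have no24 := avoid _ _ _ _ _ n24 ab2 bc2 ac2.
  have <- : psi [set a; b; c] = [set Some a; Some b; Some c].
    rewrite /psi (negPf no24); case: ifP => [/and3P[i1 _ i3]|_].
      by rewrite i1 i3 in no13.
    by rewrite !imsetU !imset_set1.
  apply: old; first by apply/triangleP; exists a, b, c.
  by apply: contra no13 => /and3P[-> ->].
- by rewrite setUC setUA; apply: new.
- by rewrite [[set Some a; None]]setUC; apply: new.
- by [].
- exact: new.
- by [].
- by [].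
- by [].
Qed.

Lemma dte_triangles_le (G : sgraph) (v1 v2 v3 v4 : G) :
  dte_site v1 v2 v3 v4 ->
  #|triangles (dte v1 v2 v3 v4)| <= #|triangles G|.+1.
Proof. by move=> /dte_triangles; apply: leq_trans; rewrite leq_addr. Qed.

(** Another common neighbour [c] of [v1] and [v3] would make [v1 c v3] a triangle
    to which nothing is charged. *)
Lemma dte_triangles_tight (G : sgraph) (v1 v2 v3 v4 c : G) :
  dte_site v1 v2 v3 v4 ->
  #|triangles (dte v1 v2 v3 v4)| = #|triangles G|.+1 ->
  adj v1 c -> adj v3 c -> c = v2.
Proof.
move=> site tight v1c v3c; apply/eqP/contraT => cv2.
have /and5P[u _ _ v13 _] := site.
have tri : [set v1; c; v3] \in triangles G.
  by apply/triangleP; exists v1, c, v3; rewrite v1c v13 adj_sym v3c.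
have := dte_triangles site; rewrite tight -[X in _ <= X]addn0 leq_add2l leqn0.
rewrite cards_eq0 => /eqP/setP/(_ [set v1; c; v3]); rewrite in_set0 in_set tri => <-.
move: u; rewrite /= !inE !negb_or !eqxx !orbT /= [v2 == v1]eq_sym [v2 == c]eq_sym.
by case/and4P=> /and3P[-> _ _] /andP[-> _]; rewrite cv2.
Qed.

(** * Expansions of the square of a cycle *)

(** The roles of [v1] and [v3] in an expansion are symmetric, which halves the
    case analysis on sites: the vertex [v4] may follow either of them. *)
Lemma dte_swap (G : sgraph) (v1 v2 v3 v4 : G) :
  graph_iso (dte v3 v2 v1 v4) (dte v1 v2 v3 v4).
Proof.
exists id; first by exists id.
move=> [a|] [b|] //=; rewrite ?inE; first by rewrite [[set v3; v1]]setUC.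
- by case: (a == v1); case: (a == v2); case: (a == v3).
- by case: (b == v1); case: (b == v2); case: (b == v3).
Qed.

(** The new vertex takes the label 2, between [v2] and [v3], and the labels from
    2 on are shifted. The deleted pairs 02 and 13 are exactly the pairs at
    distance 2 that the insertion moves to distance 3. *)
Lemma dte_cyclic_square N (G : sgraph) (g : G -> nat) (v1 v2 v3 v4 : G) :
  5 <= N -> cyc_labelling N g ->
  g v1 = 0 -> g v2 = 1 -> g v3 = 2 -> g v4 = 3 ->
  cyclic_square N.+1 (dte v1 v2 v3 v4).
Proof.
move=> N5 [EG ginj gN gadj] e1 e2 e3 e4.
have EN : #|dte v1 v2 v3 v4| = N.+1 by rewrite /= card_option EG.
have geq x y : (x == y) = (g x == g y) by rewrite (inj_eq ginj).
pose g' (x : dte v1 v2 v3 v4) :=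
  if x is Some a then if g a <= 1 then g a else (g a).+1 else 2.
exists g'; split=> //.
- move=> [a|] [b|] //=.
  + by move=> h; congr Some; apply: ginj; move: h; do 2!case: ifP; lia.
  + by case: ifP; lia.
  + by case: ifP; lia.
- by move=> [a|] /=; [have := gN a; case: ifP|]; lia.
move=> [a|] [b|] /=.
- rewrite gadj !set2_eq !geq e1 e2 e3 e4 /cyc_adj.
  have := gN a; have := gN b; do 2!case: ifP; lia.
- rewrite !inE !geq e1 e2 e3 e4 /cyc_adj; have := gN a; case: ifP; lia.
- rewrite !inE !geq e1 e2 e3 e4 /cyc_adj; have := gN b; case: ifP; lia.
by rewrite /cyc_adj; lia.
Qed.

Lemma dte_cyclic_square_swap N (G : sgraph) (g : G -> nat) (v1 v2 v3 v4 : G) :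
  5 <= N -> cyc_labelling N g ->
  g v3 = 0 -> g v2 = 1 -> g v1 = 2 -> g v4 = 3 ->
  cyclic_square N.+1 (dte v1 v2 v3 v4).
Proof.
move=> N5 gL e3 e2 e1 e4; apply: cyclic_square_iso (dte_swap v1 v2 v3 v4) _.
exact: dte_cyclic_square gL e3 e2 e1 e4.
Qed.

(** After a rotation and possibly a reflection, [v1] is 0 and [v3] is 1 or 2. The
    value 1 is impossible since both 2 and [N - 1] would label common
    neighbours. So [v1, v2, v3] are 0, 1, 2, and [v4], another neighbour of 1,
    is 3 or [N - 1]; in the latter case the site is read backwards. *)
Lemma dte_cyclic_square_large N (G : sgraph) (v1 v2 v3 v4 : G) :
  7 <= N -> cyclic_square N G -> dte_site v1 v2 v3 v4 ->
  (forall c, adj v1 c -> adj v3 c -> c = v2) ->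
  cyclic_square N.+1 (dte v1 v2 v3 v4).
Proof.
move=> N7 [g0 g0L] site only.
have N5 : 5 <= N by lia.
have [g gL [e1 g3]] :
    exists2 g, cyc_labelling N g & g v1 = 0 /\ (g v3 = 1 \/ g v3 = 2).
  have /labelling_rotate/(_ g0L) : g0 v1 < N by case: g0L.
  set g1 := fun x => _; move=> /(_ N5) g1L.
  have e1 : g1 v1 = 0 by rewrite /g1 leqnn subnn.
  case: (g1L) => _ _ g1N g1adj.
  have := g1adj v1 v3; rewrite e1; case/and5P: site => _ _ _ -> _ h.
  rewrite /cyc_adj in h.
  have [small|big] := leqP (g1 v3) 2; first by exists g1 => //; split=> //; lia.
  have z : 0 < N by lia.
  exists (fun x => if g1 x <= 0 then 0 - g1 x else 0 + N - g1 x).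
    exact: labelling_reflect.
  by rewrite e1; split=> //; case: ifP; have := g1N v3; lia.
case: (gL) => _ ginj gN gadj.
have com k : 0 < k -> k < N -> cyc_adj N 0 k -> cyc_adj N (g v3) k -> g v2 = k.
  move=> k0 kN h1 h3; have [c ck] := labelling_onto gL kN.
  by rewrite -ck; congr g; apply/esym/only; rewrite gadj ?e1 ck.
have e3 : g v3 = 2.
  case: g3 => // e3; have := com 2; have := com N.-1; rewrite e3 /cyc_adj; lia.
case/and5P: site; rewrite /= !inE !negb_or => /and4P[/and3P[_ _ n14] _ n34 _].
rewrite -(inj_eq ginj) in n14; rewrite -(inj_eq ginj) in n34.
move=> a12 a23 _ a24.
have e2 : g v2 = 1.
  by move: a12 a23; rewrite !gadj e1 e3 /cyc_adj; have := gN v2; lia.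
have [e4|e4] : g v4 = 3 \/ g v4 = N.-1.
  by move: a24 n14 n34; rewrite !gadj e1 e2 e3 /cyc_adj; have := gN v4; lia.
  exact: dte_cyclic_square gL e1 e2 e3 e4.
have c2 : 2 < N by lia.
apply: dte_cyclic_square_swap (labelling_reflect N5 c2 gL) _ _ _ _ => //.
- by rewrite e3.
- by rewrite e2.
- by rewrite e1.
- by rewrite e4; case: ifP; lia.
Qed.

(** For [N] equal to 5 or 6, sends [a, b, c, d] to 0, 1, 2, 3 and the remaining
    residues to 4 and [N - 1]. In the octahedron C_6, vertex 4 is the antipode of
    1, hence the only remaining residue that is not close to [b]. *)
Definition small_relabel N a b c d x : nat :=
  if x == a then 0 else if x == b then 1 else if x == c then 2
  else if x == d then 3 else if cyc_adj N b x then N.-1 else 4.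

Definition small_relabel_ok N a b c d : bool :=
  let p := small_relabel N a b c d in
  all (fun x => (p x < N) && all (fun y =>
    ((p x == p y) ==> (x == y)) && (cyc_adj N x y == cyc_adj N (p x) (p y)))
    (iota 0 N)) (iota 0 N).

Lemma small_relabelP N (G : sgraph) (g : G -> nat) a b c d :
  cyc_labelling N g -> small_relabel_ok N a b c d ->
  cyc_labelling N (small_relabel N a b c d \o g).
Proof.
move=> [EG ginj gN gadj] /allP ok.
have {}ok x := ok (g x); have gi x : g x \in iota 0 N by rewrite mem_iota gN.
split=> //= [x y /= E|x|x y].
- have /andP[_ /allP/(_ _ (gi y))/andP[/implyP inj _]] := ok x (gi x).
  by apply/ginj/eqP/inj/eqP.
- by have /andP[] := ok x (gi x).
have /andP[_ /allP/(_ _ (gi y))/andP[_ /eqP <-]] := ok x (gi x); exact: gadj.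
Qed.

(** In K5 any four vertices are consecutive for some labelling. In the octahedron
    [d] is the antipode of [a] or of [c], as 3 is of 0, and the sites for which it
    is the antipode of [c] need the roles of [a] and [c] exchanged. There are few
    enough quadruples to check each of them by computation. *)
Lemma small_sites_ok N : (N == 5) || (N == 6) ->
  all (fun a => all (fun b => all (fun c => all (fun d =>
    [&& uniq [:: a; b; c; d], cyc_adj N a b, cyc_adj N b c, cyc_adj N a c
      & cyc_adj N b d] ==>
    small_relabel_ok N a b c d || small_relabel_ok N c b a d)
  (iota 0 N)) (iota 0 N)) (iota 0 N)) (iota 0 N).
Proof. by case/orP=> /eqP->; vm_compute. Qed.

Lemma dte_cyclic_square_small N (G : sgraph) (v1 v2 v3 v4 : G) :
  (N == 5) || (N == 6) -> cyclic_square N G -> dte_site v1 v2 v3 v4 ->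
  cyclic_square N.+1 (dte v1 v2 v3 v4).
Proof.
move=> N56 [g gL] /and5P[u a12 a23 a13 a24]; have [EG ginj gN gadj] := gL.
have gi x : g x \in iota 0 N by rewrite mem_iota gN.
have N5 : 5 <= N by lia.
have := small_sites_ok N56.
move=> /allP/(_ _ (gi v1))/allP/(_ _ (gi v2))/allP/(_ _ (gi v3))/allP/(_ _ (gi v4)).
rewrite -!gadj a12 a23 a13 a24 (map_inj_uniq ginj [:: v1; v2; v3; v4]) u /=.
move: u; rewrite /= !inE !negb_or -!(inj_eq ginj).
case/and4P=> /and3P[n12 n13 n14] /andP[n23 n24] n34 _.
case/orP=> /(small_relabelP gL) L;
  [ apply: dte_cyclic_square L _ _ _ _
  | apply: dte_cyclic_square_swap L _ _ _ _ ] => //=;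
  rewrite /small_relabel ?eqxx //; do ! case: eqP => //; lia.
Qed.

(** * Descendants of level zero *)

(** The second clause says that the level is nonnegative from order 7 on. It is
    carried along because it forces the parent of a graph of level 0 to have
    level 0 too, the level being nondecreasing. *)
Lemma descendant_invariant (G : sgraph) : K5_descendant G ->
  [/\ 5 <= #|G|, 7 <= #|G| -> #|triangles G| <= #|G|
    & #|G| < 7 \/ #|triangles G| = #|G| -> cyclic_square #|G| G].
Proof.
elim=> {G} [G iso|G H _ [G5 Gle Gsq] [_ [v1 [v2 [v3 [v4 [site iso]]]]]]].
  have <- : 5 = #|G| by rewrite -(graph_iso_order iso) card_ord.
  by split=> // _; apply: cyclic_square_iso iso complete5_cyclic_square.
have EH : #|H| = #|G|.+1 by rewrite -(graph_iso_order iso) card_option.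
have ET := card_triangles_iso iso.
have sqH := cyclic_square_iso iso; rewrite EH.
have [G7|G7] := ltnP #|G| 7.
  have sq : cyclic_square #|G|.+1 H.
    by apply/sqH/dte_cyclic_square_small => //; [lia | apply: Gsq; left].
  split=> // [|HN]; first exact: leqW.
  by rewrite (cyclic_square_triangles HN sq).
have {}Gle := Gle G7; have le := dte_triangles_le site.
split; [exact: leqW | by move=> _; rewrite -ET (leq_trans le) |].
case=> [|eqH]; first by rewrite ltnNge (leq_trans G7 (leqnSn _)).
have tight : #|triangles G| = #|G|.
  by apply/eqP; rewrite eqn_leq Gle -ltnS -eqH -ET.
apply/sqH/dte_cyclic_square_large => //; first by apply: Gsq; right.
by move=> c; apply: dte_triangles_tight site _; rewrite ET tight.
Qed.

Lemma cyclic_square_zigzag n : 5 <= n -> cyclic_square n (zigzag1 (n - 2)).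
Proof.
by case: n => [|[|n]] // n3; rewrite subSS subSS subn0; apply: zigzag_cyclic_square.
Qed.

(** The induction expands the 1-zigzag graph of the previous order at labels 0, 1,
    2, 3; as squares of cycles of equal order are isomorphic, the result is the
    given graph. *)
Lemma cyclic_square_descendant N (G : sgraph) :
  5 <= N -> cyclic_square N G -> K5_descendant G.
Proof.
move=> N5; rewrite -(subnK N5); elim: (N - 5) G => {N N5} [|k IH] G sq.
  by apply/K5_descendant_base/(cyclic_square_unique complete5_cyclic_square).
have k5 : 5 <= k + 5 by rewrite leq_addl.
have Zsq := cyclic_square_zigzag k5; have [g gL] := Zsq.
apply: K5_descendant_step (IH _ Zsq) _.
split; first exact: cyclic_square_regular k5 Zsq.
have [v1 e1] := labelling_onto gL (leq_trans (isT : 0 < 5) k5).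
have [v2 e2] := labelling_onto gL (leq_trans (isT : 1 < 5) k5).
have [v3 e3] := labelling_onto gL (leq_trans (isT : 2 < 5) k5).
have [v4 e4] := labelling_onto gL (leq_trans (isT : 3 < 5) k5).
exists v1, v2, v3, v4; split; last first.
  exact: cyclic_square_unique (dte_cyclic_square k5 gL e1 e2 e3 e4) sq.
case: gL => _ ginj _ gadj.
by rewrite /dte_site !gadj -(map_inj_uniq ginj) /= e1 e2 e3 e4.
Qed.

Lemma descendant_level0P (G : sgraph) N : 7 <= N ->
  [/\ K5_descendant G, level G = 0%R & graph_order G = N] <-> cyclic_square N G.
Proof.
move=> N7; split=> [[/descendant_invariant[_ _ sq] /level0P l0 <-]|sq].
  by apply: sq; right.
have EN : #|G| = N by case: sq => g [].
split=> //; last by apply/level0P; rewrite EN (cyclic_square_triangles N7 sq).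
by apply: cyclic_square_descendant sq; apply: leq_trans N7.
Qed.

Theorem proposition3p2 :
  (forall N : nat, 7 <= N ->
     exists G : sgraph,
       [/\ K5_descendant G, level G = 0%R & graph_order G = N] /\
       (forall H : sgraph,
          [/\ K5_descendant H, level H = 0%R & graph_order H = N] -> graph_iso G H))
  /\
  (forall G : sgraph,
     [/\ K5_descendant G, level G = 0%R & 7 <= graph_order G] <->
     (exists n : nat, 7 <= graph_order (zigzag1 n) /\ graph_iso (zigzag1 n) G)).
Proof.
split=> [N N7|G].
  have Zsq : cyclic_square N (zigzag1 (N - 2)).
    by apply: cyclic_square_zigzag; apply: leq_trans N7.
  exists (zigzag1 (N - 2)); split; first exact/descendant_level0P.
  by move=> H /(descendant_level0P _ N7); apply: cyclic_square_unique Zsq.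
split=> [[desc l0 G7]|[n [n7 iso]]].
  have sq : cyclic_square (graph_order G) G by apply/descendant_level0P.
  have Zsq : cyclic_square (graph_order G) (zigzag1 (graph_order G - 2)).
    by apply: cyclic_square_zigzag; apply: leq_trans G7.
  exists (graph_order G - 2); split; last exact: cyclic_square_unique Zsq sq.
  by case: Zsq => g [EZ _ _ _]; rewrite /graph_order EZ.
rewrite /graph_order zigzag_order in n7.
have /(descendant_level0P _ n7)[desc l0 EG] : cyclic_square n.+2 G.
  by apply: cyclic_square_iso iso _; apply: zigzag_cyclic_square; lia.
by split=> //; rewrite EG.
Qed.
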